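(* Let $(X,J)$ be a compact almost-complex manifold of real dimension $4$ and let $\omega$ be a Hermitian metric on $(X,J)$, with associated Riemannian metric $g$. Then $$\mathcal H_g^-\subseteq \mathcal H^{1,1}_{\overline\partial},$$ where $\mathcal H_g^-$ denotes the space of anti-self-dual $d$-harmonic $(1,1)$-forms. In particular, $$h^{1,1}_{\overline\partial}\geq b_-.$$
   Context: The almost-complex structure $J$ is not assumed integrable. $X$ carries the orientation induced by $J$. A Hermitian metric on $(X,J)$ is a $J$-invariant Riemannian metric $g$, identified with its fundamental $(1,1)$-form $\omega(\cdot,\cdot)=g(J\cdot,\cdot)$. $A^{p,q}(X)$ denotes the space of smooth complex-valued $(p,q)$-forms with respect to $J$. On $A^{p,q}(X)$ the operator $\overline\partial: A^{p,q}(X)\to A^{p,q+1}(X)$ is the $(p,q+1)$-component of the exterior derivative $d$ (in general $\overline\partial^2\neq 0$), and $\overline\partial^*$ is its formal $L^2$-adjoint with respect to $g$. The $\overline\partial$-Laplacian is $\Delta_{\overline\partial}=\overline\partial\,\overline\partial^*+\overline\partial^*\overline\partial$, a second order elliptic operator. Put $\mathcal H^{p,q}_{\overline\partial}=\ker(\Delta_{\overline\partial}|_{A^{p,q}(X)})$ and $h^{p,q}_{\overline\partial}=\dim_{\mathbb C}\mathcal H^{p,q}_{\overline\partial}$, which is finite since $X$ is compact. A $2$-form $\gamma$ is anti-self-dual if $*\gamma=-\gamma$, with $*$ the Hodge operator of $g$. $b_-$ denotes the dimension of the space of anti-self-dual $d$-harmonic $2$-forms on $X$, a topological invariant of $X$.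 *)

(* Defs.v *)
From HB Require Import structures.
From mathcomp Require Import all_boot all_order all_fingroup all_algebra.
From mathcomp Require Import complex.
From mathcomp Require Import all_classical all_reals all_analysis.
Import Order.TTheory GRing.Theory Num.Theory.
Import numFieldNormedType.Exports.

Set Implicit Arguments.
Unset Strict Implicit.
Unset Printing Implicit Defensive.

Local Open Scope classical_set_scope.
Local Open Scope ring_scope.
Local Open Scope complex_scope.

Definition partial (R : realType) (a : 'I_4) (f : 'rV[R]_4 -> R) :
    'rV[R]_4 -> R :=
  fun y => 'D_(delta_mx ord0 a) f y.

Definition cpartial (R : realType) (a : 'I_4) (f : 'rV[R]_4 -> R[i]) :
    'rV[R]_4 -> R[i] :=
  fun y => partial a (fun z => complex.Re (f z)) y
       +i* partial a (fun z => complex.Im (f z)) y.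

Fixpoint Ck (R : realType) (m : nat) (U : set 'rV[R]_4) (f : 'rV[R]_4 -> R)
    : Prop :=
  (forall y, U y -> {for y, continuous f}) /\
  (if m is m'.+1 then
     forall a, (forall y, U y -> derivable f y (delta_mx ord0 a)) /\
               Ck m' U (partial a f)
   else True).

(* Only used with U open. *)
Definition smooth (R : realType) (U : set 'rV[R]_4) (f : 'rV[R]_4 -> R) :=
  forall m, Ck m U f.

Definition smoothC (R : realType) (U : set 'rV[R]_4) (f : 'rV[R]_4 -> R[i]) :=
  smooth U (fun y => complex.Re (f y)) /\ smooth U (fun y => complex.Im (f y)).

Definition point4 (R : realType) (p : R * R * R * R) : 'rV[R]_4 :=
  \row_a tnth [tuple p.1.1.1; p.1.1.2; p.1.2; p.2] a.

Local Notation lebesgue4 R :=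
  (((@lebesgue_measure R \x @lebesgue_measure R)
      \x @lebesgue_measure R) \x @lebesgue_measure R)%E.

Definition integral4 (R : realType) (D : set 'rV[R]_4) (f : 'rV[R]_4 -> R) : R :=
  (\int[lebesgue4 R]_(p in @point4 R @^-1` D) f (point4 p))%R.

Definition cintegral4 (R : realType) (D : set 'rV[R]_4) (f : 'rV[R]_4 -> R[i]) :
    R[i] :=
  integral4 D (fun y => complex.Re (f y))
  +i* integral4 D (fun y => complex.Im (f y)).

(* A chart i is the homeomorphism coord i : dom i -> coord i @` dom i, with
   inverse param i.  The index type of the atlas is arbitrary. *)
Record manifold4 (R : realType) (X : topologicalType) := Manifold4 {
  chart : Type;
  dom : chart -> set X;
  coord : chart -> X -> 'rV[R]_4;
  param : chart -> 'rV[R]_4 -> X;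
  X_hausdorff : hausdorff_space X;
  X_second_countable : @second_countable X;
  dom_open : forall i, open (dom i);
  dom_cover : forall x, exists i, dom i x;
  img_open : forall i, open (coord i @` dom i);
  coordK : forall i x, dom i x -> param i (coord i x) = x;
  coord_continuous : forall i x, dom i x -> {for x, continuous (coord i)};
  param_continuous : forall i y, (coord i @` dom i) y ->
    {for y, continuous (param i)};
  transition_smooth : forall i j a,
    smooth (coord i @` (dom i `&` dom j)) (fun y => coord j (param i y) ord0 a)
}.

Section Manifold.
Context {R : realType} {X : topologicalType} (M : manifold4 R X).
Implicit Types (i j : chart M) (y : 'rV[R]_4).

Definition img i : set 'rV[R]_4 := coord i @` dom i.

Definition overlap i j : set 'rV[R]_4 := coord i @` (dom i `&` dom j).

Definition transition i j y : 'rV[R]_4 := coord j (param i y).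

(* Tangent vectors are columns: chart j sees jac i j y *m v for v in chart i. *)
Definition jac i j y : 'M[R]_4 :=
  \matrix_(b, a) partial a (fun z => transition i j z ord0 b) y.

(* Tensor fields are families of components, one in each chart, as functions
   of the coordinates; only the values on img i matter. *)
Record almost_complex := AlmostComplex {
  Jmx :> chart M -> 'rV[R]_4 -> 'M[R]_4;
  J_smooth : forall i b a, smooth (img i) (fun y => Jmx i y b a);
  J_compat : forall i j y, overlap i j y ->
    Jmx j (transition i j y) *m jac i j y = jac i j y *m Jmx i y;
  J_square : forall i y, img i y -> Jmx i y *m Jmx i y = - 1%:M
}.

(* The Riemannian metric g; the fundamental form is g (J u, v). *)
Record hermitian_metric (J : almost_complex) := Hermitian {
  gmx :> chart M -> 'rV[R]_4 -> 'M[R]_4;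
  g_smooth : forall i b a, smooth (img i) (fun y => gmx i y b a);
  g_compat : forall i j y, overlap i j y ->
    gmx i y = (jac i j y)^T *m gmx j (transition i j y) *m jac i j y;
  g_sym : forall i y, img i y -> (gmx i y)^T = gmx i y;
  g_pos : forall i y (v : 'cV[R]_4), img i y -> v != 0 ->
    0 < (v^T *m gmx i y *m v) ord0 ord0;
  g_invariant : forall i y, img i y ->
    (J i y)^T *m gmx i y *m J i y = gmx i y
}.

(* A finite family, each member supported in the domain of a chart; these
   exist because the manifold is compact. *)
Record partition_of_unity := PartitionOfUnity {
  psize : nat;
  pchart : 'I_psize -> chart M;
  pfun : 'I_psize -> X -> R;
  pfun_continuous : forall l, continuous (pfun l);
  pfun_ge0 : forall l x, 0 <= pfun l x;
  pfun_sum : forall x, \sum_l pfun l x = 1;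
  pfun_supp : forall l, closure [set x | pfun l x != 0] `<=` dom (pchart l)
}.

(* alpha i y I is the value of alpha on the coordinate vectors of chart i
   indexed by I, at the point of coordinates y. *)
Definition cform (k : nat) := chart M -> 'rV[R]_4 -> k.-tuple 'I_4 -> R[i].

(* Components of (v_1, ..., v_k) |-> t (P_1 v_1, ..., P_k v_k), for a covariant
   tensor t extended multilinearly to complex vectors. *)
Definition pull (k : nat) (P : 'I_k -> 'M[R[i]]_4) (t : k.-tuple 'I_4 -> R[i]) :
    k.-tuple 'I_4 -> R[i] :=
  fun I => \sum_(K : k.-tuple 'I_4) t K * \prod_b P b (tnth K b) (tnth I b).

(* Components are set to 0 outside the image of the chart, so that equality of
   forms is equality of families. *)
Definition smooth_form (k : nat) : set (cform k) :=
  [set alpha : cform k |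
    [/\ forall i I, smoothC (img i) (fun y => alpha i y I),
        forall i y I, ~ img i y -> alpha i y I = 0,
        forall i y (s : 'S_k) I,
          alpha i y [tuple tnth I (s b) | b < k] = (-1) ^+ s * alpha i y I &
        forall i j y, overlap i j y ->
          alpha i y =
          pull (fun=> map_mx (real_complex R) (jac i j y))
               (alpha j (transition i j y))]].

Definition ext_d (k : nat) (alpha : cform k) : cform k.+1 := fun i y I =>
  if `[< img i y >] then
    \sum_(a < k.+1) (-1) ^+ a *
      cpartial (tnth I a)
        (fun z => alpha i z [tuple tnth I (lift a b) | b < k]) y
  else 0.

Section Hermitian.
Context {J : almost_complex} (g : hermitian_metric J) (rho : partition_of_unity).

(* Pointwise Hermitian product of k-forms, linear in the first argument. *)
Definition pairing (k : nat) (alpha beta : cform k) i y : R[i] :=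
  (k`!%:R)^-1 * \sum_(I : k.-tuple 'I_4) \sum_(K : k.-tuple 'I_4)
    (\prod_(b < k) (invmx (g i y) (tnth I b) (tnth K b))%:C)
    * alpha i y I * conjc (beta i y K).

(* Integral over X of <alpha, beta> against the Riemannian volume, whose
   density in a chart is sqrt (det g).  The value on continuous forms does not
   depend on rho. *)
Definition L2 (k : nat) (alpha beta : cform k) : R[i] :=
  \sum_(l < psize rho) cintegral4 (img (pchart l)) (fun y =>
    (pfun l (param (pchart l) y) * Num.sqrt (\det (g (pchart l) y)))%:C
    * pairing alpha beta (pchart l) y).

(* Sign of the coordinate frame for the orientation induced by J, in which
   (u, J u, v, J v) is positive. *)
Definition orient i y : R :=
  if `[< exists u v : 'cV[R]_4,
           0 < \det (row_mx (row_mx u (J i y *m u)) (row_mx v (J i y *m v))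
                     : 'M[R]_4) >]
  then 1 else -1.

Definition levi_civita (a b c e : 'I_4) : R :=
  \det (\matrix_(r < 4, s < 4) (tnth [tuple a; b; c; e] r == s)%:R).

(* ( *gamma)_(c e) = sqrt(det g) / 2 * gamma^(a b) * epsilon_(a b c e) *)
Definition hodge_star (gamma : cform 2) : cform 2 := fun i y I =>
  (orient i y * Num.sqrt (\det (g i y)) / 2)%:C *
  \sum_a \sum_b \sum_a' \sum_b'
    (invmx (g i y) a a' * invmx (g i y) b b'
     * levi_civita a b (tnth I ord0) (tnth I ord_max))%:C
    * gamma i y [tuple a'; b'].

Definition anti_self_dual (gamma : cform 2) :=
  forall i y I, hodge_star gamma i y I = - gamma i y I.

(* Projections of the complexified tangent space on the (+i)- and
   (-i)-eigenspaces of J: (1 - i J)/2 and (1 + i J)/2. *)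
Definition proj10 i y : 'M[R[i]]_4 :=
  2^-1 *: (1%:M - (0 +i* 1) *: map_mx (real_complex R) (J i y)).
Definition proj01 i y : 'M[R[i]]_4 :=
  2^-1 *: (1%:M + (0 +i* 1) *: map_mx (real_complex R) (J i y)).

(* Component of bidegree (p, k - p) of a k-form: the sum over all ways of
   feeding p slots with (1,0)-vectors and the others with (0,1)-vectors. *)
Definition bidegree_part (k p : nat) (alpha : cform k) : cform k := fun i y I =>
  \sum_(S : {set 'I_k} | #|S| == p)
    pull (fun b => if b \in S then proj10 i y else proj01 i y) (alpha i y) I.

(* A^{p, k - p}(X), for p <= k *)
Definition Apq (k p : nat) : set (cform k) :=
  [set alpha | smooth_form alpha /\ bidegree_part p alpha = alpha].

Definition dbar (k p : nat) (alpha : cform k) : cform k.+1 :=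
  bidegree_part p (ext_d alpha).

(* gamma is the image of beta under the formal adjoint of D : A -> B.  The
   adjoint is given by its graph; gamma is unique as L2 is positive definite. *)
Definition is_formal_adjoint (k : nat) (D : cform k -> cform k.+1)
    (A : set (cform k)) (B : set (cform k.+1))
    (beta : cform k.+1) (gamma : cform k) :=
  [/\ B beta, A gamma & forall phi, A phi -> L2 (D phi) beta = L2 phi gamma].

(* Kernel in A1 of D0 D0^* + D1^* D1, for D0 : A0 -> A1 and D1 : A1 -> A2. *)
Definition laplacian_kernel (k : nat)
    (D0 : cform k -> cform k.+1) (D1 : cform k.+1 -> cform k.+2)
    (A0 : set (cform k)) (A1 : set (cform k.+1)) (A2 : set (cform k.+2)) :
    set (cform k.+1) :=
  [set alpha | A1 alpha /\
    exists beta gamma,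
      [/\ is_formal_adjoint D0 A0 A1 alpha beta,
          is_formal_adjoint D1 A1 A2 (D1 alpha) gamma &
          forall i y I, D0 beta i y I + gamma i y I = 0]].

Definition d_harmonic (k : nat) : set (cform k.+1) :=
  laplacian_kernel (@ext_d k) (@ext_d k.+1)
    (@smooth_form k) (@smooth_form k.+1) (@smooth_form k.+2).

(* H^{p,q} of the dbar-Laplacian, in total degree p + q = k + 1 *)
Definition dbar_harmonic (k p : nat) : set (cform k.+1) :=
  laplacian_kernel (@dbar k p) (@dbar k.+1 p)
    (@Apq k p) (@Apq k.+1 p) (@Apq k.+2 p).

Definition H11_dbar : set (cform 2) := @dbar_harmonic 1 1.

Definition Hminus : set (cform 2) :=
  [set alpha | [/\ @Apq 2 1 alpha, d_harmonic alpha & anti_self_dual alpha]].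

End Hermitian.

(* Linear independence over the field F, embedded in R[i] by f. *)
Definition lin_indep (F : zmodType) (f : F -> R[i]) (k n : nat)
    (e : 'I_n -> cform k) :=
  forall c : 'I_n -> F,
    (forall i y I, \sum_a f (c a) * e a i y I = 0) -> forall a, c a = 0.

(* In \bar R, so that no finiteness is built in. *)
Definition vdim (F : zmodType) (f : F -> R[i]) (k : nat) (V : set (cform k)) :
    \bar R :=
  ereal_sup [set (n%:R)%:E | n in
    [set n | exists e : 'I_n -> cform k, (forall a, V (e a)) /\ lin_indep f e]].

Definition dimR (k : nat) (V : set (cform k)) := vdim (real_complex R) V.
Definition dimC (k : nat) (V : set (cform k)) := vdim (@id R[i]) V.

Definition real_form (k : nat) : set (cform k) :=
  [set alpha : cform k | forall i y I, complex.Im (alpha i y I) = 0].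

Definition h11_dbar (J : almost_complex) (g : hermitian_metric J)
    (rho : partition_of_unity) := dimC (H11_dbar g rho).

Definition bminus (J : almost_complex) (g : hermitian_metric J)
    (rho : partition_of_unity) :=
  dimR [set alpha : cform 2 |
    [/\ real_form alpha, d_harmonic g rho alpha & anti_self_dual g alpha]].

End Manifold.

(* Main.v *)
Require Import Defs.
From mathcomp Require Import all_boot all_order all_fingroup all_algebra.
From mathcomp Require Import ring lra.
From mathcomp Require Import complex.
From mathcomp Require Import all_classical all_reals all_analysis.
Import Order.TTheory GRing.Theory Num.Theory.
Import numFieldNormedType.Exports.
(* Defs comes last: [coord] is also a name of mathcomp's vector library. *)
Import Defs.

Set Implicit Arguments.
Unset Strict Implicit.
Unset Printing Implicit Defensive.

(* Pairing the Laplacian of a d-harmonic form alpha with alpha, and using that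
   the L2 product is positive definite on smooth forms, gives d alpha = 0 and
   <d phi, alpha> = 0 for all phi.  If alpha has bidegree (1,1), then
   dbar alpha = 0 as a component of d alpha; and since the projection on a
   bidegree is pointwise self-adjoint, <dbar phi, alpha> = <d phi, alpha> = 0
   for phi of bidegree (1,0).  So both terms of the dbar-Laplacian vanish.

   For the inequality, in a unitary frame (u, J u, v, J v), which is positively
   oriented, the equations * gamma = - gamma say that the antisymmetric matrix
   of gamma is J-invariant, so real anti-self-dual forms have bidegree (1,1);
   and real forms independent over the reals are independent over the complex
   numbers. *)

Local Open Scope classical_set_scope.
Local Open Scope ring_scope.
Local Open Scope complex_scope.

(** * Tensors at a point *)

Lemma prod_sum_tuple (A : comPzRingType) (T : finType) (k : nat)
    (F : 'I_k -> T -> A) :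
  \prod_b \sum_a F b a = \sum_(I : k.-tuple T) \prod_b F b (tnth I b).
Proof.
rewrite bigA_distr_bigA /= (reindex (fun I : k.-tuple T => [ffun b => tnth I b])) /=.
  by apply: eq_bigr => I _; apply: eq_bigr => b _; rewrite ffunE.
exists (fun f => [tuple f b | b < k]) => [I _|f _].
  by apply: eq_from_tnth => b; rewrite tnth_mktuple ffunE.
by apply/ffunP => b; rewrite ffunE tnth_mktuple.
Qed.

Section TensorAlgebra.
Context {R : realType}.
Local Notation C := R[i].

(** The Hermitian adjoint: entrywise conjugation together with transposition. *)
Definition conj_mx n (A : 'M[C]_n) : 'M[C]_n := (map_mx conjc A)^T.

(** Each slot carries its own Gram matrix because the bidegree projections act on different slots by
    different matrices. Pulling back an argument then multiplies these matrices slot by slot. *)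
Definition sesq (k : nat) (h : 'I_k -> 'M[C]_4) (t u : k.-tuple 'I_4 -> C) : C :=
  \sum_(I : k.-tuple 'I_4) \sum_(K : k.-tuple 'I_4)
    (\prod_(b < k) h b (tnth I b) (tnth K b)) * t I * conjc (u K).

Lemma pull_comp (k : nat) (P Q : 'I_k -> 'M[C]_4) t :
  pull P (pull Q t) = pull (fun b => Q b *m P b) t.
Proof.
apply/funext => I; rewrite /pull.
under eq_bigr do rewrite mulr_suml.
rewrite exchange_big /=; apply: eq_bigr => K _.
under eq_bigr do rewrite -mulrA -big_split /=.
rewrite -mulr_sumr; congr (_ * _).
rewrite -(prod_sum_tuple (fun b a => Q b (tnth K b) a * P b a (tnth I b))).
by apply: eq_bigr => b _; rewrite mxE.
Qed.

Lemma pull1 (k : nat) (t : k.-tuple 'I_4 -> C) : pull (fun=> 1%:M) t = t.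
Proof.
apply/funext => I; rewrite /pull (bigD1 I) //= [X in _ * X]big1 => [|b _].
  rewrite mulr1 big1 ?addr0// => K nKI.
  have /existsP[b nb] : [exists b, tnth K b != tnth I b].
    apply: contraNT nKI; rewrite negb_exists => /forallP H.
    by apply/eqP/eq_from_tnth => b; apply/eqP; rewrite -[_ == _]negbK H.
  by rewrite (bigD1 b)//= mxE (negPf nb) mul0r mulr0.
by rewrite mxE eqxx.
Qed.

Lemma pull0 (k : nat) (P : 'I_k -> 'M[C]_4) : pull P (fun=> 0) = (fun=> 0).
Proof. by apply/funext => I; rewrite /pull big1// => K _; rewrite mul0r. Qed.

Lemma sesq_conj (k : nat) h (t u : k.-tuple 'I_4 -> C) :
  conjc (sesq h t u) = sesq (fun b => conj_mx (h b)) u t.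
Proof.
rewrite /sesq [in RHS]exchange_big rmorph_sum /=; apply: eq_bigr => I _.
rewrite rmorph_sum /=; apply: eq_bigr => K _.
rewrite !rmorphM /= conjcK mulrAC rmorph_prod; congr (_ * _ * _).
by apply: eq_bigr => b _; rewrite !mxE.
Qed.

Lemma sesq_pulll (k : nat) h P (t u : k.-tuple 'I_4 -> C) :
  sesq h (pull P t) u = sesq (fun b => P b *m h b) t u.
Proof.
rewrite /sesq exchange_big [RHS]exchange_big; apply: eq_bigr => K _.
rewrite -!mulr_suml; congr (_ * _); rewrite /pull.
under eq_bigr do rewrite mulr_sumr.
rewrite exchange_big /=; apply: eq_bigr => L _.
under eq_bigr do rewrite mulrCA.
rewrite -mulr_sumr mulrC; congr (_ * _).
transitivity (\sum_(I : k.-tuple 'I_4)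
    \prod_b (h b (tnth I b) (tnth K b) * P b (tnth L b) (tnth I b))).
  by apply: eq_bigr => I _; rewrite big_split.
rewrite -(prod_sum_tuple (fun b a => h b a (tnth K b) * P b (tnth L b) a)).
by apply: eq_bigr => b _; rewrite mxE; apply: eq_bigr => a _; rewrite mulrC.
Qed.

Lemma conj_mxK n : involutive (@conj_mx n).
Proof. by move=> A; apply/matrixP => a b; rewrite !mxE conjcK. Qed.

Lemma conj_mxM n (A B : 'M[C]_n) : conj_mx (A *m B) = conj_mx B *m conj_mx A.
Proof. by rewrite /conj_mx map_mxM trmx_mul. Qed.

Lemma sesq_pullr (k : nat) h P (t u : k.-tuple 'I_4 -> C) :
  sesq h t (pull P u) = sesq (fun b => h b *m conj_mx (P b)) t u.
Proof.
apply: (can_inj (@conjcK R)); rewrite !sesq_conj sesq_pulll.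
by congr sesq; apply/funext => b; rewrite conj_mxM conj_mxK.
Qed.

Lemma sesq1 (k : nat) (t u : k.-tuple 'I_4 -> C) :
  sesq (fun=> 1%:M) t u = \sum_I t I * conjc (u I).
Proof.
rewrite /sesq exchange_big; apply: eq_bigr => K _; rewrite -mulr_suml.
congr (_ * _); rewrite -[in RHS](pull1 t) /pull.
by apply: eq_bigr => I _; rewrite mulrC.
Qed.

(** Moving the two factors of each Gram matrix onto the arguments leaves the standard Hermitian
    product, so positivity and definiteness reduce to those of a sum of squared moduli. *)
Lemma sesq_gram (k : nat) P (t : k.-tuple 'I_4 -> C) :
  sesq (fun b => P b *m conj_mx (P b)) t t =
  \sum_I pull P t I * conjc (pull P t I).
Proof.
rewrite -sesq1 sesq_pulll sesq_pullr; congr sesq.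
by apply/funext => b; rewrite mulmx1.
Qed.

Lemma sesq_gram_ge0 (k : nat) P (t : k.-tuple 'I_4 -> C) :
  0 <= sesq (fun b => P b *m conj_mx (P b)) t t.
Proof. by rewrite sesq_gram; apply: sumr_ge0 => I _; exact: mulcJ_ge0. Qed.

Lemma sesq_gram_eq0 (k : nat) P (t : k.-tuple 'I_4 -> C) :
  (forall b, P b \in unitmx) ->
  sesq (fun b => P b *m conj_mx (P b)) t t = 0 -> t = (fun=> 0).
Proof.
move=> uP; rewrite sesq_gram => S0.
have P0 : pull P t = (fun=> 0).
  apply/funext => I; apply/eqP.
  have /eqP := S0; rewrite psumr_eq0; last by move=> J _; exact: mulcJ_ge0.
  by move/allP => /(_ I); rewrite mem_index_enum mulf_eq0 conjc_eq0 orbb; apply.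
(* Pulling back by the inverse matrices recovers [t] from [pull P t]. *)
rewrite -[t]pull1 -[RHS](pull0 (fun b => invmx (P b))) -P0 pull_comp.
by congr pull; apply/funext => b; rewrite mulmxV.
Qed.

End TensorAlgebra.

(** * Unitary frames *)

(** The expanded 4 by 4 determinant. Indices are natural numbers so that entries given by [nth] on
    lists reduce by computation, leaving identities for [ring]. *)
Definition leibniz4 (A : comPzRingType) (f : nat -> nat -> A) : A :=
    f 0 0 * f 1 1 * f 2 2 * f 3 3 - f 0 0 * f 1 1 * f 2 3 * f 3 2
  - f 0 0 * f 1 2 * f 2 1 * f 3 3 + f 0 0 * f 1 2 * f 2 3 * f 3 1
  + f 0 0 * f 1 3 * f 2 1 * f 3 2 - f 0 0 * f 1 3 * f 2 2 * f 3 1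
  - f 0 1 * f 1 0 * f 2 2 * f 3 3 + f 0 1 * f 1 0 * f 2 3 * f 3 2
  + f 0 1 * f 1 2 * f 2 0 * f 3 3 - f 0 1 * f 1 2 * f 2 3 * f 3 0
  - f 0 1 * f 1 3 * f 2 0 * f 3 2 + f 0 1 * f 1 3 * f 2 2 * f 3 0
  + f 0 2 * f 1 0 * f 2 1 * f 3 3 - f 0 2 * f 1 0 * f 2 3 * f 3 1
  - f 0 2 * f 1 1 * f 2 0 * f 3 3 + f 0 2 * f 1 1 * f 2 3 * f 3 0
  + f 0 2 * f 1 3 * f 2 0 * f 3 1 - f 0 2 * f 1 3 * f 2 1 * f 3 0
  - f 0 3 * f 1 0 * f 2 1 * f 3 2 + f 0 3 * f 1 0 * f 2 2 * f 3 1
  + f 0 3 * f 1 1 * f 2 0 * f 3 2 - f 0 3 * f 1 1 * f 2 2 * f 3 0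
  - f 0 3 * f 1 2 * f 2 0 * f 3 1 + f 0 3 * f 1 2 * f 2 1 * f 3 0.

Lemma det_mx44 (A : comPzRingType) (f : nat -> nat -> A) :
  \det (\matrix_(r < 4, s < 4) f r s) = leibniz4 f.
Proof.
rewrite /leibniz4.
do 3! (rewrite !(expand_det_row _ ord0) !big_ord_recl !big_ord0 /cofactor).
rewrite !det_mx11 !mxE /= /bump /= !(expr0, expr1, addn0, add0n, addn1) /=.
rewrite ?exprS ?expr0.
ring.
Qed.

Section Frames.
Context {R : realType}.
Local Notation C := R[i].
Implicit Types (u v : 'cV[R]_4) (P g j : 'M[R]_4).

(** Written as the same block matrix as in [orient], so that the two match by conversion. *)
Definition frame j u v : 'M[R]_4 :=
  row_mx (row_mx u (j *m u)) (row_mx v (j *m v)).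

Lemma frameE j u v : frame j u v =
  \matrix_(r, s) (nth 0 [:: u; j *m u; v; j *m v] s) r ord0.
Proof.
apply/matrixP => r s; rewrite /frame [in LHS]mxE [in RHS]mxE.
case: splitP => s' /= ->; rewrite mxE; case: splitP => s'' /= ->;
  by case: s'' => [[|//] ?] /=; congr (fun_of_matrix _ _ _); apply: val_inj.
Qed.

Lemma mul_frameE P j u v : P *m frame j u v =
  \matrix_(r, s) (nth 0 [:: P *m u; P *m (j *m u); P *m v; P *m (j *m v)] s) r ord0.
Proof.
apply/matrixP => r s; rewrite frameE [LHS]mxE [RHS]mxE.
under eq_bigr do rewrite [(\matrix_(_, _) _) _ _]mxE.
by case: s => [[|[|[|[|//]]]] ?] /=; rewrite [RHS]mxE.
Qed.

Lemma mul_frame P j0 j u v :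
  P *m j0 = j *m P -> P *m frame j0 u v = frame j (P *m u) (P *m v).
Proof. by move=> PJ; rewrite mul_frameE frameE !mulmxA PJ. Qed.

(** Multiplication by i on C^2, in the real coordinates (Re z1, Im z1, Re z2, Im z2). *)
Definition J0 : 'M[R]_4 :=
  \matrix_(r, s) nth 0 (nth [::] [:: [:: 0; -1; 0; 0]; [:: 1; 0; 0; 0];
                                     [:: 0; 0; 0; -1]; [:: 0; 0; 1; 0]] r) s.

(** Both sides have columns j u, - u, j v, - v; thus [J0] is the matrix of j in such a frame. *)
Lemma frame_J0 j u v : j *m j = - 1%:M -> frame j u v *m J0 = j *m frame j u v.
Proof.
move=> jj.
have jjw w : j *m (j *m w) = - w by rewrite mulmxA jj mulNmx mul1mx.
rewrite mul_frameE !jjw frameE; apply/matrixP => r s; rewrite [LHS]mxE [in RHS]mxE.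
rewrite !big_ord_recl big_ord0.
do !rewrite [J0 _ _]mxE; do !rewrite [(\matrix_(_, _) _) _ _]mxE.
case: s => [[|[|[|[|//]]]] ?] /=;
  by rewrite ?(mulr0, mulr1, mulrN1, add0r, addr0) // ?mxE.
Qed.

(* The determinant is the squared modulus of the complex determinant of the two
   vectors. *)
Lemma det_frame_J0_ge0 u v : 0 <= \det (frame J0 u v).
Proof.
pose a n : R := u (inord n) ord0; pose b n : R := v (inord n) ord0.
(* [J0l] is the action of [J0] on coordinates numbered by naturals, the form in which [det_mx44]
   applies. *)
pose J0l (w : nat -> R) := nth 0 [:: - w 1%N; w 0%N; - w 3%N; w 2%N].
have J0w (w : 'cV[R]_4) (r : 'I_4) :
    (J0 *m w) r ord0 = J0l (fun n => w (inord n) ord0) r.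
  rewrite mxE.
  under eq_bigr => s _ do rewrite mxE -{2}[s]inord_val.
  rewrite !big_ord_recl big_ord0 /J0l.
  by case: r => [[|[|[|[|//]]]] ?] /=;
    rewrite !(mul0r, mul1r, mulN1r, add0r, addr0).
rewrite frameE.
have -> : \matrix_(r < 4, s < 4) (nth 0 [:: u; J0 *m u; v; J0 *m v] s) r ord0 =
    \matrix_(r < 4, s < 4) nth 0 [:: a r; J0l a r; b r; J0l b r] s.
  apply/matrixP => r s; rewrite !mxE.
  by case: s => [[|[|[|[|//]]]] ?] //=; rewrite ?J0w ?/a ?/b ?inord_val.
rewrite (det_mx44 (fun r s => nth 0 [:: a r; J0l a r; b r; J0l b r] s)).
rewrite /J0l /leibniz4 /=.
apply: (@le_trans _ _
  ((a 0%N * b 2%N - a 1%N * b 3%N - a 2%N * b 0%N + a 3%N * b 1%N) ^+ 2 +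
   (a 0%N * b 3%N + a 1%N * b 2%N - a 2%N * b 1%N - a 3%N * b 0%N) ^+ 2)).
  by rewrite addr_ge0 ?sqr_ge0.
by rewrite le_eqVlt; apply/orP; left; apply/eqP; ring.
Qed.

End Frames.

(** * Orthonormal frames adapted to a Hermitian structure on R^4 *)

Section HermitianFrame.
Context {R : realType}.
Implicit Types (x y : 'cV[R]_4).
Variables (j g : 'M[R]_4).
Hypothesis jj : j *m j = - 1%:M.
Hypothesis gT : g^T = g.
Hypothesis gpos : forall x, x != 0 -> 0 < (x^T *m g *m x) ord0 ord0.
Hypothesis gj : j^T *m g *m j = g.

Let ip x y := (x^T *m g *m y) ord0 ord0.

Let ipC x y : ip x y = ip y x.
Proof.
transitivity ((y^T *m g *m x)^T ord0 ord0); last by rewrite mxE.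
by rewrite !trmx_mul trmxK gT mulmxA.
Qed.

Let ipZl c x y : ip (c *: x) y = c * ip x y.
Proof. by rewrite /ip linearZ /= -!scalemxAl mxE. Qed.

Let ipJ x y : ip (j *m x) (j *m y) = ip x y.
Proof. by rewrite /ip trmx_mul -{2}gj !mulmxA. Qed.

Let ip_Jr x y : ip x (j *m y) = - ip (j *m x) y.
Proof.
by rewrite -ipJ mulmxA jj mulNmx mul1mx /ip mulmxN mxE.
Qed.

Let ip_xJx x : ip x (j *m x) = 0.
Proof. by have := ip_Jr x x; rewrite (ipC (j *m x)); lra. Qed.

Let unit_multiple x : x != 0 -> exists c, ip (c *: x) (c *: x) = 1.
Proof.
move=> /gpos; rewrite -/(ip x x) => x0; exists (Num.sqrt (ip x x))^-1.
rewrite ipZl ipC ipZl mulrA -expr2 exprVn sqr_sqrtr ?ltW// mulVf ?gt_eqF//.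
Qed.

Let gram (F : 'I_4 -> 'cV[R]_4) (Q := \matrix_(r, s) F s r ord0) :
  Q^T *m g *m Q = \matrix_(r, s) ip (F r) (F s).
Proof.
apply/matrixP => r s; rewrite [RHS]mxE /ip !mxE; apply: eq_bigr => a _.
by rewrite !mxE; congr (_ * _); apply: eq_bigr => b _; rewrite !mxE.
Qed.

(** Complex Gram-Schmidt: take a unit u, then a unit v orthogonal to u and j u. Since j is an
    isometry with square -1, it is skew for g, and the remaining orthogonality relations follow. *)
Lemma unitary_frame : exists u v, (frame j u v)^T *m g *m frame j u v = 1%:M.
Proof.
have [u uu] : exists u, ip u u = 1.
  have /unit_multiple[c ?] : (delta_mx ord0 ord0 : 'cV[R]_4) != 0;
    last by exists (c *: delta_mx ord0 ord0).
  by apply/eqP => /matrixP/(_ ord0 ord0); rewrite !mxE => /eqP; rewrite oner_eq0.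
have [v [vv uv juv]] : exists v, [/\ ip v v = 1, ip u v = 0 & ip (j *m u) v = 0].
  (* Orthogonality to u and j u imposes two linear conditions on a row of length four, so a nonzero
     solution exists. *)
  pose A := row_mx (g *m u) (g *m (j *m u)).
  have kA : kermx A != 0.
    by rewrite -mxrank_eq0 mxrank_ker -lt0n subn_gt0 (leq_ltn_trans (rank_leq_col A)).
  pose w := nz_row (kermx A).
  have wA : w *m A = 0 by apply/sub_kermxP; exact: nz_row_sub.
  have wn0 : w^T != 0 by rewrite -trmx0 (inj_eq trmx_inj) nz_row_eq0.
  have [c cw] := unit_multiple wn0.
  have [w1 w2] : w *m (g *m u) = 0 /\ w *m (g *m (j *m u)) = 0.
    by move: wA; rewrite mul_mx_row -row_mx0 => /eq_row_mx.
  exists (c *: w^T); split=> //.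
  - by rewrite ipC ipZl /ip trmxK -mulmxA w1 mxE mulr0.
  - by rewrite ipC ipZl /ip trmxK -mulmxA w2 mxE mulr0.
exists u, v; rewrite frameE (gram (fun s : 'I_4 => nth 0 [:: u; j *m u; v; j *m v] s)).
have vu := uv; rewrite ipC in vu.
have vju := juv; rewrite ipC in vju.
have ujv : ip u (j *m v) = 0 by rewrite ip_Jr juv oppr0.
have jvu := ujv; rewrite ipC in jvu.
have jxx x : ip (j *m x) x = 0 by rewrite ipC ip_xJx.
apply/matrixP => -[[|[|[|[|//]]]] ?] -[[|[|[|[|//]]]] ?]; rewrite !mxE /=;
  by rewrite ?ipJ ?ip_xJx ?jxx ?uu ?vv ?uv ?vu ?juv ?vju ?ujv ?jvu.
Qed.

End HermitianFrame.

(** A one-sided inverse of a square matrix is two-sided. An orthonormal frame thus writes the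
    inverse metric as a Gram matrix, as both the Hodge operator and the pointwise product
    require. *)
Lemma invmx_gram (F : fieldType) n (P g : 'M[F]_n) :
  P^T *m g *m P = 1%:M -> P \in unitmx /\ invmx g = P *m P^T.
Proof.
move=> PgP; have PPg : P *m P^T *m g = 1%:M by rewrite -mulmxA; apply: mulmx1C.
have [_ ug] := mulmx1_unit PPg; have [_ uP] := mulmx1_unit PgP; split=> //.
by rewrite -[RHS]mulmx1 -(mulmxV ug) mulmxA PPg mul1mx.
Qed.

(** * The Hodge operator in a unitary frame *)

Section Hodge.
Context {R : realType}.
Local Notation C := R[i].
Local Notation toC := (real_complex R).
Local Notation eps := (@levi_civita R).
Implicit Types (P g j : 'M[R]_4) (G : 'M[C]_4).

Lemma sum_delta (A : pzRingType) (T : finType) (x : T) (F : T -> A) :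
  \sum_a (a == x)%:R * F a = F x.
Proof.
rewrite (bigD1 x)//= eqxx mul1r big1 ?addr0// => a /negPf->.
by rewrite mul0r.
Qed.

(** Both sides are the determinant of the matrix formed from the columns m, n, r, s of [P]: the
    right one by multiplicativity, the left one by the Leibniz formula. *)
Lemma levi_civita_mul P (m n r s : 'I_4) :
  \sum_a \sum_b \sum_c \sum_e
    eps a b c e * (P a m * P b n * P c r * P e s) =
  \det P * eps m n r s.
Proof.
have -> : \det P * eps m n r s =
    \det (\matrix_(p < 4, q < 4) P q (tnth [tuple m; n; r; s] p)).
  rewrite -det_tr mulrC -det_mulmx; congr (\det _); apply/matrixP => p q.
  rewrite !mxE; under eq_bigr do rewrite !mxE eq_sym.
  exact: sum_delta.
rewrite /levi_civita /determinant.
under eq_bigr do under eq_bigr do under eq_bigr do under eq_bigr do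
  rewrite mulr_suml.
under eq_bigr do under eq_bigr do under eq_bigr do rewrite exchange_big.
under eq_bigr do under eq_bigr do rewrite exchange_big.
under eq_bigr do rewrite exchange_big.
rewrite exchange_big; apply: eq_bigr => sg _ /=.
have reorder (z a b c e t : R) :
  z * (a * (b * (c * (e * 1)))) * t = a * (b * (c * (e * (z * t)))) by ring.
pose i1 : 'I_4 := lift ord0 (ord0 : 'I_3).
pose i2 : 'I_4 := lift ord0 (lift ord0 (ord0 : 'I_2)).
pose i3 : 'I_4 := lift ord0 (lift ord0 (lift ord0 (ord0 : 'I_1))).
(* For a fixed permutation the Levi-Civita term is a product of four Kronecker deltas, so the
   fourfold sum collapses to one term. *)
transitivity (\sum_a (a == sg ord0)%:R * \sum_b (b == sg i1)%:R *
    \sum_c (c == sg i2)%:R * \sum_e (e == sg i3)%:R *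
      ((-1) ^+ sg * (P a m * P b n * P c r * P e s))).
  apply: eq_bigr => a _; rewrite mulr_sumr.
  apply: eq_bigr => b _; rewrite !mulr_sumr.
  apply: eq_bigr => c _; rewrite !mulr_sumr.
  apply: eq_bigr => e _; rewrite !big_ord_recl big_ord0 !mxE !(tnth_nth ord0) /=.
  exact: reorder.
rewrite !sum_delta !big_ord_recl big_ord0 !mxE !(tnth_nth ord0) /=.
by rewrite mulr1 !mulrA.
Qed.

Lemma mulmx_trE (n : nat) (A M B : 'M[C]_n) a b :
  (A *m M *m B^T) a b = \sum_m \sum_n A a m * B b n * M m n.
Proof.
rewrite exchange_big mxE; apply: eq_bigr => n' _; rewrite !mxE mulr_suml.
by apply: eq_bigr => m _; rewrite mulrAC.
Qed.

(** The change of frame in the Hodge operator. Raising both indices of [G] gives [Pc *m E *m Pc^T],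
    with [E] the matrix of [G] in the frame [P]; with the two frame vectors in the free slots, four
    factors [P] meet the Levi-Civita symbol and produce [\det P]. *)
Lemma levi_civita_pull P G (h := P *m P^T) (r s : 'I_4) :
  \sum_c \sum_e toC (P c r) * toC (P e s) *
    (\sum_a \sum_b \sum_a' \sum_b'
      toC (h a a' * h b b' * eps a b c e) * G a' b') =
  toC (\det P) * \sum_m \sum_n toC (eps m n r s) *
    ((map_mx toC P)^T *m G *m map_mx toC P) m n.
Proof.
set Pc := map_mx toC P; set E := _ *m _ *m _.
have hGh : map_mx toC h *m G *m (map_mx toC h)^T = Pc *m E *m Pc^T.
  by rewrite /h /E !map_mxM !trmx_mul !map_trmx trmxK !mulmxA.
transitivity (\sum_c \sum_e \sum_a \sum_b \sum_m \sum_n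
    toC (eps a b c e * (P a m * P b n * P c r * P e s)) * E m n).
  apply: eq_bigr => c _; apply: eq_bigr => e _; rewrite mulr_sumr.
  apply: eq_bigr => a _; rewrite mulr_sumr; apply: eq_bigr => b _.
  transitivity (toC (P c r) * toC (P e s) * toC (eps a b c e) *
      (Pc *m E *m Pc^T) a b).
    rewrite -hGh mulmx_trE !mulr_sumr.
    apply: eq_bigr => a' _; rewrite !mulr_sumr; apply: eq_bigr => b' _.
    by rewrite !mxE !rmorphM /=; ring.
  rewrite mulmx_trE mulr_sumr; apply: eq_bigr => m _.
  rewrite mulr_sumr; apply: eq_bigr => n _.
  by rewrite !mxE !rmorphM /=; ring.
transitivity (\sum_m \sum_n \sum_a \sum_b \sum_c \sum_e
    toC (eps a b c e * (P a m * P b n * P c r * P e s)) * E m n); last first.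
  rewrite mulr_sumr; apply: eq_bigr => m _.
  rewrite mulr_sumr; apply: eq_bigr => n _.
  rewrite mulrA -rmorphM -levi_civita_mul rmorph_sum mulr_suml.
  apply: eq_bigr => a _; rewrite rmorph_sum mulr_suml.
  apply: eq_bigr => b _; rewrite rmorph_sum mulr_suml.
  apply: eq_bigr => c _; rewrite rmorph_sum mulr_suml.
  by apply: eq_bigr => e _.
(* Only the order of summation differs; with indices grouped in pairs, one exchange on the outside
   and one on the inside suffice. *)
rewrite pair_bigA [RHS]pair_bigA /=.
under eq_bigr do rewrite pair_bigA; under [RHS]eq_bigr do rewrite pair_bigA.
under eq_bigr do under eq_bigr do rewrite pair_bigA.
under [RHS]eq_bigr do under eq_bigr do rewrite pair_bigA.
rewrite exchange_big [RHS]exchange_big; apply: eq_bigr => p _ /=.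
exact: exchange_big.
Qed.

(** [J0] preserves the entries 01 and 23 of every antisymmetric matrix. Invariance of the others
    amounts to E13 = E02 and E03 = - E12, which are the anti-self-duality equations at (0,2) and
    (0,3). *)
Lemma antiselfdual_coords (E : 'M[C]_4) : E^T = - E ->
  (forall r s, 2^-1 * \sum_m \sum_n toC (eps m n r s) * E m n = - E r s) ->
  (map_mx toC J0)^T *m E *m map_mx toC J0 = E.
Proof.
move=> ET asd.
have Ea r s : E r s = - E s r by have /matrixP/(_ s r) := ET; rewrite !mxE.
(* [o] keeps [inord] opaque: the entries of [E] stay atoms for [field], and indices are evaluated
   only through [oE]. *)
have [ o oE] : exists f : nat -> 'I_4, forall n, (n < 4)%N -> f n = n :> nat.
  by exists inord => n; exact: inordK.
have epsE (a b c e : nat) : (a < 4)%N -> (b < 4)%N -> (c < 4)%N -> (e < 4)%N ->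
  eps (o a) (o b) (o c) (o e) =
    leibniz4 (fun p q => (nth 0%N [:: a; b; c; e] p == q)%:R).
  move=> a4 b4 c4 e4; rewrite -det_mx44; congr (\det _).
  apply/matrixP => p q; rewrite !mxE (tnth_nth ord0) -val_eqE /=.
  by case: p => [[|[|[|[|//]]]] ?] /=; rewrite oE.
have sum4 (F : 'I_4 -> C) : \sum_a F a = F (o 0) + F (o 1) + F (o 2) + F (o 3).
  rewrite !big_ord_recl big_ord0 addr0 !addrA.
  by congr (F _ + F _ + F _ + F _); apply: val_inj; rewrite /= oE.
have E13 : E (o 1) (o 3) = E (o 0) (o 2).
  have := asd (o 0) (o 2); rewrite !sum4 !epsE // /leibniz4 /=.
  by rewrite (Ea (o 3) (o 1)) => H; apply: oppr_inj; rewrite -H; field.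
have E03 : E (o 0) (o 3) = - E (o 1) (o 2).
  have := asd (o 0) (o 3); rewrite !sum4 !epsE // /leibniz4 /=.
  by rewrite (Ea (o 2) (o 1)) => H; apply: oppr_inj; rewrite -H; field.
have Err r : E r r = 0 by apply/eqP; rewrite -eqNr -Ea.
suff EJ a b : (a < 4)%N -> (b < 4)%N ->
    ((map_mx toC J0)^T *m E *m ((map_mx toC J0)^T)^T) (o a) (o b) = E (o a) (o b).
  apply/matrixP => r s; have oV t : o (t : 'I_4) = t by apply: val_inj; rewrite /= oE.
  by have := EJ r s; rewrite trmxK !oV; apply.
rewrite mulmx_trE !sum4 !mxE.
case: a b => [|[|[|[|//]]]] [|[|[|[|//]]]] _ _; rewrite !oE //=.
all: rewrite !(rmorph0, rmorphN, rmorph1, mul0r, mulr0, addr0, add0r, mul1r,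
  mulN1r, opprK, mulrN, mulr1).
all: by rewrite ?(Err, Ea (o 1) (o 0), Ea (o 2) (o 0), Ea (o 2) (o 1),
  Ea (o 3) (o 0), Ea (o 3) (o 1), Ea (o 3) (o 2), E13, E03, opprK).
Qed.

(** Taking determinants in P^T g P = 1 gives sqrt(det g) = 1 / |det P|. The orientation sign is that
    of det P, because every frame (u, j u, v, j v) is [P] times a frame for [J0], whose determinant
    is nonnegative. *)
Lemma orient_frame j g u v (P := frame j u v)
    (o : R := if `[< exists u v : 'cV[R]_4, 0 < \det (frame j u v) >] then 1 else -1) :
  j *m j = - 1%:M -> P^T *m g *m P = 1%:M ->
  o * Num.sqrt (\det g) = (\det P)^-1.
Proof.
move=> jj PgP.
have dP : \det P ^+ 2 * \det g = 1.
  by rewrite -(det1 _ 4) -PgP !det_mulmx det_tr mulrAC.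
have P0 : \det P != 0.
  by apply/eqP => P0; move/eqP: dP; rewrite P0 expr0n mul0r eq_sym oner_eq0.
have -> : \det g = (\det P)^-2.
  by apply: (mulfI (expf_neq0 2 P0)); rewrite dP mulfV ?expf_neq0.
rewrite -exprVn sqrtr_sqr /o; case: asboolP => [[u' [v' uv]]|nuv].
  have uP : P \in unitmx by rewrite unitmxE unitfE.
  have : 0 < \det P.
    have PJ : P *m J0 = j *m P by exact: frame_J0.
    move: uv; rewrite -[u'](mulKVmx uP) -[v'](mulKVmx uP) -(mul_frame _ _ PJ) det_mulmx.
    set d := \det (frame J0 _ _).
    have d0 : 0 <= d by exact: det_frame_J0_ge0.
    move=> dPd; rewrite lt_neqAle eq_sym P0 leNgt; apply/negP => dP0.
    by move: dPd; rewrite ltNge mulr_le0_ge0 // ltW.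
  by rewrite -invr_gt0 mul1r => /gtr0_norm.
have : \det P <= 0 by rewrite leNgt; apply/negP => P1; apply: nuv; exists u, v.
by rewrite -invr_le0 mulN1r => /ler0_norm ->; rewrite opprK.
Qed.

(** In a unitary frame the volume factor 1 / det P cancels the det P coming from [levi_civita_pull],
    which leaves the flat equations of [antiselfdual_coords]; the resulting [J0]-invariance is
    carried back to j by j P = P [J0]. *)
Lemma antiselfdual_type11 j g G
    (o : R := if `[< exists u v : 'cV[R]_4, 0 < \det (frame j u v) >] then 1 else -1) :
  j *m j = - 1%:M -> g^T = g ->
  (forall x : 'cV[R]_4, x != 0 -> 0 < (x^T *m g *m x) ord0 ord0) ->
  j^T *m g *m j = g -> G^T = - G ->
  (forall c e, toC (o * Num.sqrt (\det g) / 2) *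
    (\sum_a \sum_b \sum_a' \sum_b'
      toC (invmx g a a' * invmx g b b' * eps a b c e) * G a' b') =
    - G c e) ->
  (map_mx toC j)^T *m G *m map_mx toC j = G.
Proof.
move=> jj gT gpos gj GT asd.
have [u [v PgP]] := unitary_frame jj gT gpos gj.
have oE := orient_frame jj PgP.
have PJ := frame_J0 u v jj.
move: PgP oE PJ; set P := frame j u v => PgP oE PJ.
have [uP gV] := invmx_gram PgP.
set Pc := map_mx toC P; pose E := Pc^T *m G *m Pc.
have uPc : Pc \in unitmx by rewrite map_unitmx.
have uPcT : Pc^T \in unitmx by rewrite unitmx_tr.
have EJ : (map_mx toC J0)^T *m E *m map_mx toC J0 = E.
  apply: antiselfdual_coords.
    by rewrite /E !trmx_mul trmxK GT mulNmx mulmxN mulmxA.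
  move=> r s; rewrite /E.
  have P0 : \det P != 0 by rewrite -unitfE -unitmxE.
  have := levi_civita_pull P G r s; rewrite -gV -/Pc -/E => H.
  have {H} -> : \sum_m \sum_n toC (eps m n r s) * E m n =
    toC (\det P)^-1 * \sum_c \sum_e toC (P c r) * toC (P e s) *
    (\sum_a \sum_b \sum_a' \sum_b'
      toC (invmx g a a' * invmx g b b' * eps a b c e) * G a' b').
    by rewrite H mulrA -rmorphM mulVf// mul1r.
  have -> : E = Pc^T *m G *m (Pc^T)^T by rewrite trmxK.
  rewrite -oE mulrA mulr_sumr mulmx_trE -sumrN.
  apply: eq_bigr => c _; rewrite mulr_sumr -sumrN; apply: eq_bigr => e _.
  rewrite mulrCA -[in RHS]mulrN -asd !mxE [toC (_ / _)]rmorphM fmorphV.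
  by rewrite rmorph_nat [2^-1 * _]mulrC.
(* Multiplying by the invertible [Pc^T] and [Pc] reduces the goal to the invariance of [E]. *)
apply: (can_inj (mulKmx uPcT)); apply: (can_inj (mulmxK uPc)).
have jP : map_mx toC j *m Pc = Pc *m map_mx toC J0 by rewrite -!map_mxM PJ.
have jPT : Pc^T *m (map_mx toC j)^T = (map_mx toC J0)^T *m Pc^T.
  by rewrite -!trmx_mul jP.
transitivity ((map_mx toC J0)^T *m E *m map_mx toC J0); last exact: EJ.
by rewrite /E !mulmxA jPT -[LHS]mulmxA jP mulmxA.
Qed.

End Hodge.

(** * Bidegrees and the pointwise product *)

Section Pointwise.
Context {R : realType} {X : topologicalType} {M : manifold4 R X}.
Context {J : almost_complex M} (g : hermitian_metric J).
Local Notation C := R[i].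
Local Notation toC := (real_complex R).

Lemma tuple2E (T : Type) (I : 2.-tuple T) : I = [tuple tnth I ord0; tnth I ord_max].
Proof. by case: I => [[|a [|b [|? ?]]] ?] //; apply: val_inj. Qed.

Lemma sum_tuple2 (V : nmodType) (T : finType) (F : 2.-tuple T -> V) :
  \sum_K F K = \sum_a \sum_b F [tuple a; b].
Proof.
rewrite pair_bigA /= (reindex (fun p : T * T => [tuple p.1; p.2])) //=.
exists (fun K => (tnth K ord0, tnth K ord_max)) => [[a b] _|K _] //=.
by rewrite -tuple2E.
Qed.

Lemma pull2 (P : 'I_2 -> 'M[C]_4) (t : 2.-tuple 'I_4 -> C) a b :
  pull P t [tuple a; b] =
  ((P ord0)^T *m (\matrix_(c, e) t [tuple c; e]) *m P ord_max) a b.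
Proof.
rewrite -[P ord_max]trmxK mulmx_trE /pull sum_tuple2.
apply: eq_bigr => c _; apply: eq_bigr => e _.
have i1 : lift ord0 ord0 = ord_max :> 'I_2 by exact: val_inj.
by rewrite !big_ord_recl big_ord0 !mxE mulr1 mulrC i1.
Qed.

(** The (1,1)-part of a bilinear form G is (G + J^T G J) / 2, hence G itself when G is
    J-invariant. *)
Lemma bidegree_part11 (gamma : cform M 2) i y
    (G := \matrix_(a, b) gamma i y [tuple a; b]) :
  (map_mx toC (J i y))^T *m G *m map_mx toC (J i y) = G ->
  bidegree_part (J := J) 1 gamma i y = gamma i y.
Proof.
move=> JGJ; apply/funext => I.
rewrite [I]tuple2E; move: (tnth I ord0) (tnth I ord_max) => a b.
(* The subsets of cardinality one are the two singletons, according to which slot receives the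
   (1,0)-projection. *)
rewrite /bidegree_part (bigD1 [set ord0]%SET) ?cards1 //=.
rewrite (bigD1 [set ord_max]%SET) ?cards1 //=; last first.
  by rewrite (inj_eq finset.set1_inj).
rewrite big1 ?addr0; last first.
  move=> S /andP[/andP[/cards1P[[[|[|//]] ?] ->]]].
  - by rewrite (inj_eq finset.set1_inj) -val_eqE.
  - by rewrite !(inj_eq finset.set1_inj) -!val_eqE.
rewrite !pull2 !inE /= -/G (_ : gamma i y _ = G a b); last by rewrite mxE.
set Jc := map_mx toC (J i y) in JGJ *.
have : (proj10 (J := J) i y)^T *m G *m proj01 (J := J) i y +
    (proj01 (J := J) i y)^T *m G *m proj10 (J := J) i y = G.
  rewrite /proj10 /proj01 -/Jc; set K := _ *: Jc.
  have trZ c (A : 'M[C]_4) : (c *: A)^T = c *: A^T by exact: linearZ.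
  have trD (A B : 'M[C]_4) : (A + B)^T = A^T + B^T by exact: linearD.
  have trB (A B : 'M[C]_4) : (A - B)^T = A^T - B^T by exact: linearB.
  have KGK : K^T *m G *m K = - G.
    rewrite /K trZ -!scalemxAl -scalemxAr scalerA JGJ.
    by rewrite -expr2 sqr_i scaleN1r.
  rewrite !trZ -!scalemxAl -!scalemxAr !scalerA trB trD trmx1.
  rewrite !(mulmxBl, mulmxDl, mulmxBr, mulmxDr).
  rewrite !(mul1mx, mulmx1) KGK.
  move: (K^T *m G) (G *m K) => Y Z; apply/matrixP => c e; rewrite !mxE; by field.
by move=> /matrixP/(_ a b) <-; rewrite [RHS]mxE.
Qed.

Definition inv_metric i y : 'M[C]_4 := map_mx toC (invmx (g i y)).

Lemma pairingE k (alpha beta : cform M k) i y :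
  pairing g alpha beta i y =
  (k`!%:R)^-1 * sesq (fun=> inv_metric i y) (alpha i y) (beta i y).
Proof.
rewrite /pairing /sesq; congr (_ * _).
apply: eq_bigr => I _; apply: eq_bigr => K _; congr (_ * _ * _).
by apply: eq_bigr => b _; rewrite mxE.
Qed.

Lemma metric_det_gt0 i y : img (M := M) i y -> 0 < \det (g i y).
Proof.
move=> iy; have [u [v PgP]] := unitary_frame (J_square J iy) (g_sym g iy)
  (fun w => g_pos g iy (v := w)) (g_invariant g iy).
move: PgP (invmx_gram PgP) => /(congr1 determinant).
rewrite !det_mulmx det_tr det1 mulrAC -expr2 => dP [].
rewrite unitmxE unitfE => P0 _; have : 0 < \det (frame (J i y) u v) ^+ 2.
  by rewrite lt_neqAle sqr_ge0 eq_sym expf_neq0.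
by move/pmulr_rgt0 <-; rewrite dP.
Qed.

Lemma metric_unit i y : img (M := M) i y -> g i y \in unitmx.
Proof. by move=> /metric_det_gt0 d0; rewrite unitmxE unitfE gt_eqF. Qed.

Lemma pairing_conj k (alpha beta : cform M k) i y : img (M := M) i y ->
  pairing g alpha beta i y = conjc (pairing g beta alpha i y).
Proof.
move=> iy; rewrite !pairingE rmorphM /= sesq_conj fmorphV rmorph_nat.
congr (_ * sesq _ _ _); apply/funext => _; apply/matrixP => a b.
have gVT : (invmx (g i y))^T = invmx (g i y) by rewrite trmx_inv g_sym.
by rewrite !mxE conjc_real -[in LHS]gVT mxE.
Qed.

(** J is skew for the invariant metric, and conjugating i brings a second sign; so i J, and with it
    both projections, is Hermitian for the inverse metric. *)
Lemma proj_self_adjoint i y (e : bool)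
    (p := if e then proj10 (J := J) i y else proj01 (J := J) i y) :
  img (M := M) i y -> p *m inv_metric i y = inv_metric i y *m conj_mx p.
Proof.
move=> iy; have jj := J_square J iy; have gj := g_invariant g iy.
have ug := metric_unit iy.
have Jh : invmx (g i y) *m (J i y)^T = - (J i y *m invmx (g i y)).
  have jg : (J i y)^T *m g i y = - (g i y *m J i y).
    by rewrite -{2}gj -!mulmxA jj !mulmxN mulmx1 opprK.
  rewrite -[LHS]mulmx1 -(mulmxV ug) mulmxA -[X in X *m _]mulmxA jg.
  by rewrite mulmxN mulmxA mulVmx // mul1mx mulNmx.
have JhC : inv_metric i y *m (map_mx toC (J i y))^T =
    - (map_mx toC (J i y) *m inv_metric i y).
  by rewrite /inv_metric map_trmx -!map_mxM Jh map_mxN.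
have cJ : conj_mx (map_mx toC (J i y)) = (map_mx toC (J i y))^T.
  by apply/matrixP => a b; rewrite !mxE conjc_real.
have cZ (c : C) (A : 'M[C]_4) : conj_mx (c *: A) = conjc c *: conj_mx A.
  by apply/matrixP => a b; rewrite !mxE rmorphM.
have cD (A B : 'M[C]_4) : conj_mx (A + B) = conj_mx A + conj_mx B.
  by apply/matrixP => a b; rewrite !mxE rmorphD.
have cN (A : 'M[C]_4) : conj_mx (- A) = - conj_mx A.
  by apply/matrixP => a b; rewrite !mxE rmorphN.
have c1 : conj_mx (1%:M : 'M[C]_4) = 1%:M.
  by apply/matrixP => a b; rewrite !mxE rmorph_nat eq_sym.
have ci : conjc (0 +i* 1 : C) = - (0 +i* 1).
  by apply/eqP; rewrite eq_complex /= oppr0 !eqxx.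
rewrite /p; case: e @p => p; rewrite /p /proj10 /proj01 cZ cD ?cN cZ c1 cJ;
  rewrite ci fmorphV rmorph_nat -scalemxAl -scalemxAr; congr (_ *: _);
  rewrite mulmxDl mulmxDr ?(mulNmx, mulmxN) mul1mx mulmx1; congr (_ + _);
  by rewrite -scalemxAl -scalemxAr JhC scaleNr scalerN ?opprK.
Qed.

Lemma sesq_suml (k : nat) (T : finType) (Q : pred T) h
    (t : T -> k.-tuple 'I_4 -> C) u :
  sesq h (fun I => \sum_(x | Q x) t x I) u = \sum_(x | Q x) sesq h (t x) u.
Proof.
rewrite /sesq [RHS]exchange_big; apply: eq_bigr => I _.
rewrite [RHS]exchange_big; apply: eq_bigr => K _.
by rewrite mulr_sumr mulr_suml.
Qed.

Lemma sesq_sumr (k : nat) (T : finType) (Q : pred T) h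
    t (u : T -> k.-tuple 'I_4 -> C) :
  sesq h t (fun I => \sum_(x | Q x) u x I) = \sum_(x | Q x) sesq h t (u x).
Proof.
apply: (can_inj (@conjcK R)); rewrite sesq_conj sesq_suml rmorph_sum.
by apply: eq_bigr => x _; rewrite /= sesq_conj.
Qed.

Lemma pairing_bidegree_part k p (alpha beta : cform M k) i y :
  img (M := M) i y ->
  pairing g (bidegree_part (J := J) p alpha) beta i y =
  pairing g alpha (bidegree_part (J := J) p beta) i y.
Proof.
move=> iy; rewrite !pairingE; congr (_ * _).
rewrite /bidegree_part sesq_suml sesq_sumr; apply: eq_bigr => S _.
rewrite sesq_pulll sesq_pullr; congr (sesq _ _ _); apply/funext => b.
by have := proj_self_adjoint (b \in S) iy.
Qed.

Lemma inv_metric_gram i y : img (M := M) i y ->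
  exists2 P : 'M[C]_4, P \in unitmx & inv_metric i y = P *m conj_mx P.
Proof.
move=> iy.
have [u [v /invmx_gram[uP gV]]] := unitary_frame (J_square J iy) (g_sym g iy)
  (fun w => g_pos g iy (v := w)) (g_invariant g iy).
exists (map_mx toC (frame (J i y) u v)); first by rewrite map_unitmx.
rewrite /inv_metric gV map_mxM; congr (_ *m _).
by apply/matrixP => a b; rewrite !mxE conjc_real.
Qed.

Lemma pairing_ge0 k (beta : cform M k) i y : img (M := M) i y ->
  0 <= pairing g beta beta i y.
Proof.
move=> /inv_metric_gram[P _ gP]; rewrite pairingE gP.
by apply: mulr_ge0; [rewrite invr_ge0 ler0n | exact: sesq_gram_ge0].
Qed.

Lemma pairing_eq0 k (beta : cform M k) i y : img (M := M) i y ->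
  pairing g beta beta i y = 0 -> beta i y = fun=> 0.
Proof.
move=> /inv_metric_gram[P uP gP] /eqP; rewrite pairingE gP mulf_eq0.
rewrite invr_eq0 pnatr_eq0 gtn_eqF ?fact_gt0 //= => /eqP.
by apply: sesq_gram_eq0.
Qed.

End Pointwise.

(** * Integration and the L2 product *)

Section NonnegativeIntegral.
Local Open Scope ereal_scope.
Context d (T : measurableType d) (R : realType).
Variable mu : {measure set T -> \bar R}.
Implicit Types (D B : set T).

(* The integral of a nonnegative function is a supremum over simple functions,
   so monotonicity needs no measurability. *)
Lemma ge0_le_integral_patch D B (f h : T -> \bar R) :
  (forall x, D x -> 0 <= f x) -> (forall x, B x -> 0 <= h x) ->
  (forall x, (f \_ D) x <= (h \_ B) x) ->
  \int[mu]_(x in D) f x <= \int[mu]_(x in B) h x.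
Proof.
move=> f0 h0 fh; rewrite !ge0_integralE //.
apply: le_ereal_sup => _ [s /= sf <-]; exists s => //= x.
exact: le_trans (sf x) (fh x).
Qed.

Lemma integral_ge_cst D B (f : T -> \bar R) c : d.-measurable B -> B `<=` D ->
  (forall x, D x -> 0 <= f x) -> (0 <= c) -> (forall x, B x -> c <= f x) ->
  c * mu B <= \int[mu]_(x in D) f x.
Proof.
move=> mB BD f0 c0 cf; rewrite -integral_cst //.
apply: ge0_le_integral_patch => // x; rewrite /patch.
case: ifPn => [/set_mem Bx|_]; first by rewrite mem_set ?cf//; exact: BD.
by case: ifPn => // /set_mem /f0.
Qed.

Lemma integral_le_cst D B (f : T -> \bar R) c : d.-measurable B ->
  (forall x, D x -> 0 <= f x) -> (0 <= c) ->
  (forall x, D x -> f x <= c) -> (forall x, D x -> ~ B x -> f x = 0) ->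
  \int[mu]_(x in D) f x <= c * mu B.
Proof.
move=> mB f0 c0 fc fB; rewrite -integral_cst //.
apply: ge0_le_integral_patch => // x; rewrite /patch.
case: (pselect (B x)) => [Bx|nBx].
  by rewrite [x \in B]mem_set //; case: ifPn => // /set_mem /fc.
by rewrite [x \in B]memNset //; case: ifPn => // /set_mem Dx; rewrite fB.
Qed.

End NonnegativeIntegral.

(** * Integration over subsets of R^4 *)

Section Integral4.
Context {R : realType}.
Implicit Types (D : set 'rV[R]_4) (f : 'rV[R]_4 -> R).

Local Notation lebesgue := (@lebesgue_measure R).
Local Notation lebesgue4 :=
  (((lebesgue \x lebesgue) \x lebesgue) \x lebesgue)%E.

Lemma eq_integral4 D f h : (forall y, D y -> f y = h y) ->
  integral4 D f = integral4 D h.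
Proof.
move=> fh; apply: eq_Rintegral => p /set_mem; exact: fh.
Qed.

Lemma integral4_ge0 D f : (forall y, D y -> 0 <= f y) -> 0 <= integral4 D f.
Proof. by move=> f0; apply: Rintegral_ge0 => p; exact: f0. Qed.

(** No integrability is assumed: negation exchanges the positive and negative parts, and if one of
    their integrals is infinite both sides take the default value 0. *)
Lemma integral4N D f : integral4 D (fun y => - f y) = - integral4 D f.
Proof.
rewrite /integral4 /Rintegral integralE [in RHS]integralE.
set F := fun p => (f (point4 p))%:E.
have -> : (fun p => (- f (point4 p))%:E) = (\- F)%E by apply/funext.
rewrite funeposN funenegN.
set I1 := integral _ _ _; set I2 := integral _ _ _.
have : (0 <= I1)%E by apply: integral_ge0 => p _; exact: funeneg_ge0.
have : (0 <= I2)%E by apply: integral_ge0 => p _; exact: funepos_ge0.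
case: I1 I2 => [a| |] [b| |] //= _ _; rewrite ?oppr0 //.
by rewrite opprB.
Qed.

(** The closed cube of centre y and side 2r, nested in pairs to match the iterated product
    measure. *)
Definition box (y : 'rV[R]_4) (r : R) : set (R * R * R * R) :=
  let I a := [set` `[y ord0 a - r, y ord0 a + r]] in
  ((I (inord 0) `*` I (inord 1)) `*` I (inord 2)) `*` I (inord 3).

Lemma boxP y r p : box y r p <-> forall a, `|point4 p ord0 a - y ord0 a| <= r.
Proof.
have I a t : [set` `[y ord0 a - r, y ord0 a + r]] t <-> `|t - y ord0 a| <= r.
  by rewrite /= in_itv /= ler_distl.
have pE a : point4 p ord0 (inord a) = 
    nth 0 [:: p.1.1.1; p.1.1.2; p.1.2; p.2] (inord a : 'I_4).
  by rewrite mxE (tnth_nth 0).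
split=> [[[[/I p0 /I p1] /I p2] /I p3] a|bp].
  rewrite -[a]inord_val pE inordK //.
  by case: a => [[|[|[|[|//]]]] ?] /=.
have := fun n => bp (inord n); move=> {}bp.
split; [split; [split|]|]; apply/I; [have := bp 0%N | have := bp 1%N
  | have := bp 2%N | have := bp 3%N]; by rewrite pE inordK.
Qed.

Local Notation mR := (measurableTypeR R).

Lemma measurable_box y r : measurable (box y r : set (mR * mR * mR * mR)).
Proof.
have mI (i : interval R) : measurable ([set` i] : set mR) := measurable_itv i.
by rewrite /box; do 3! [apply: measurableX; last exact: mI]; exact: mI.
Qed.

Lemma measure_box y r : 0 < r -> lebesgue4 (box y r) = ((r *+ 2) ^+ 4)%:E.
Proof.
move=> r0; have E a : lebesgue [set` `[y ord0 a - r, y ord0 a + r]] = (r *+ 2)%:E.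
  rewrite lebesgue_measure_itv /= lte_fin ltrD2l gtrN// -EFinD.
  by congr (_%:E); rewrite mulr2n; ring.
have mI (i : interval R) : measurable ([set` i] : set mR) := measurable_itv i.
rewrite (_ : ((r *+ 2) ^+ 4)%:E =
  (r *+ 2)%:E * (r *+ 2)%:E * (r *+ 2)%:E * (r *+ 2)%:E)%E.
  apply: etrans (product_measure1E _ _ _ _) _;
    [|exact: mI|congr (_ * _)%E; last exact: E].
    by do 2! [apply: measurableX; last exact: mI]; exact: mI.
  apply: etrans (product_measure1E _ _ _ _) _;
    [|exact: mI|congr (_ * _)%E; last exact: E].
    by apply: measurableX; exact: mI.
  by apply: etrans (product_measure1E _ _ _ _) _;
    [exact: mI..|congr (_ * _)%E; exact: E].
by rewrite -!EFinM !exprS expr0 mulr1 !mulrA.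
Qed.

(** If f y > 0, then by continuity f exceeds f y / 2 on a small cube, and the extended integral is
    positive. The bounds [C] and [N] make it finite, so that the real value 0 cannot be the default
    for an infinite integral. *)
Lemma integral4_eq0 D f (C N : R) : open D ->
  (forall y, D y -> 0 <= f y) -> (forall y, D y -> {for y, continuous f}) ->
  (forall y, D y -> f y <= C) -> (forall y, D y -> f y != 0 -> `|y| <= N) ->
  integral4 D f = 0 -> forall y, D y -> f y = 0.
Proof.
move=> oD f0 fc fC fN I0 y Dy; apply/eqP; rewrite eq_le f0 // andbT leNgt.
apply/negP => fy.
have C0 : 0 <= C by rewrite (le_trans (ltW fy)) ?fC.
have fhalf : f y / 2 < f y by rewrite ltr_pdivrMr // mulr_natr mulr2n ltrDl.
have /nbhs_ballP[r /= r0 yr] : nbhs y (D `&` [set z | f y / 2 < f z]).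
  apply: filterI; first exact: open_nbhs_nbhs.
  apply: (fc y Dy [set t | f y / 2 < t]).
  by apply: open_nbhs_nbhs; split => //; exact: open_gt.
have boxD p : box y (r / 2) p -> ball y r (point4 p).
  move=> /boxP bp; split=> // i a; rewrite (ord1 i) /ball /= distrC.
  by rewrite (le_lt_trans (bp a)) // ltr_pdivrMr // mulr_natr mulr2n ltrDl.
have f0E p : (@point4 R @^-1` D) p -> (0 <= (f (point4 p))%:E)%E.
  by move=> Dp; rewrite lee_fin f0.
have lower : (((f y / 2) * ((r / 2) *+ 2) ^+ 4)%:E <=
    \int[lebesgue4]_(p in @point4 R @^-1` D) (f (point4 p))%:E)%E.
  rewrite EFinM -(@measure_box y) ?divr_gt0 //.
  apply: integral_ge_cst => //; first exact: measurable_box.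
  - by move=> p /boxD /yr[].
  - by rewrite lee_fin divr_ge0 // ltW.
  - by move=> p /boxD /yr[_ /= ?]; rewrite lee_fin ltW.
have upper : (\int[lebesgue4]_(p in @point4 R @^-1` D) (f (point4 p))%:E <=
    (C * ((`|N| + 1) *+ 2) ^+ 4)%:E)%E.
  (* The radius [|N| + 1] is positive, as [measure_box] requires. *)
  rewrite EFinM -(@measure_box 0) ?ltr_wpDl //.
  apply: integral_le_cst => //; first exact: measurable_box.
  - by move=> p Dp; rewrite lee_fin fC.
  - move=> p Dp nbox; congr (_%:E); apply/eqP; apply: contra_notT nbox => fp.
    apply/boxP => a; rewrite [X in _ - X]mxE subr0.
    rewrite (@le_trans _ _ `|point4 p|) //.
      rewrite [leRHS]mx_normrE.
      exact: (le_bigmax _ (fun ij : 'I_1 * 'I_4 => `|point4 p ij.1 ij.2|) (ord0, a)).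
    by rewrite (le_trans (fN _ Dp fp)) // (le_trans (ler_norm N)) // lerDl.
move: I0 lower upper; rewrite /integral4 /Rintegral.
case: (integral _ _ _) => [t| |] //=; rewrite ?leNgt ?ltey //.
move=> ->; rewrite !lte_fin => /negP[].
by rewrite mulr_gt0 ?divr_gt0 // exprn_gt0 // mulrn_wgt0 // divr_gt0.
Qed.

End Integral4.

(** * Continuity at a point of matrix and complex expressions *)

Section Continuity.
Context {R : realType} {T : topologicalType}.
Local Notation C := R[i].
Implicit Types (x : T).

Definition cont_at (f : T -> R) x := {for x, continuous f}.

Lemma continuous_at_sum (I : Type) (r : seq I) (Q : pred I) (F : I -> T -> R) x :
  (forall i, cont_at (F i) x) ->
  cont_at (fun z => \sum_(i <- r | Q i) F i z) x.
Proof.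
move=> cF; elim: r => [|i r IH].
  by under eq_fun do rewrite big_nil; exact: cvg_cst.
under eq_fun do rewrite big_cons; case: (Q i) => //.
exact: (continuousD (cF i) IH).
Qed.

Lemma continuous_at_prod (I : Type) (r : seq I) (Q : pred I) (F : I -> T -> R) x :
  (forall i, cont_at (F i) x) ->
  cont_at (fun z => \prod_(i <- r | Q i) F i z) x.
Proof.
move=> cF; elim: r => [|i r IH].
  by under eq_fun do rewrite big_nil; exact: cvg_cst.
under eq_fun do rewrite big_cons; case: (Q i) => //.
exact: (continuousM (cF i) IH).
Qed.

Lemma continuous_at_det n (A : T -> 'M[R]_n) x :
  (forall a b, cont_at (fun z => A z a b) x) ->
  cont_at (fun z => \det (A z)) x.
Proof.
move=> cA; apply: continuous_at_sum => s; apply: continuousM; first exact: cvg_cst.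
exact: continuous_at_prod.
Qed.

(** [invmx] is defined by cases; near x, where the determinant stays nonzero, it agrees with the
    adjugate formula. *)
Lemma continuous_at_invmx n (A : T -> 'M[R]_n) x a b : A x \in unitmx ->
  (forall a b, cont_at (fun z => A z a b) x) ->
  cont_at (fun z => invmx (A z) a b) x.
Proof.
move=> ux cA; have cdet := continuous_at_det cA.
have d0 : \det (A x) != 0 by rewrite -unitfE -unitmxE.
have E z : \det (A z) != 0 ->
    (\det (A z))^-1 * cofactor (A z) b a = invmx (A z) a b.
  by rewrite -unitfE -unitmxE => uz; rewrite /invmx uz !mxE.
rewrite /cont_at /prop_for /continuous_at -E //.
apply: cvg_trans.
  apply: (@near_eq_cvg _ _ _ _ (fun z => (\det (A z))^-1 * cofactor (A z) b a)).
  by near=> z; apply: E; near: z; exact: cvgr_neq0 cdet d0.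
apply: cvgM; first exact: cvgV.
apply: cvgM; first exact: cvg_cst.
by apply: continuous_at_det => c e; under eq_fun do rewrite !mxE; exact: cA.
Unshelve. all: by end_near. Qed.

Definition continuousC_at (f : T -> C) x :=
  cont_at (fun z => complex.Re (f z)) x /\
  cont_at (fun z => complex.Im (f z)) x.

Lemma continuousC_real (f : T -> R) x :
  cont_at f x -> continuousC_at (fun z => (f z)%:C) x.
Proof. by move=> cf; split => //=; exact: cvg_cst. Qed.

Lemma continuousC_cst (c : C) x : continuousC_at (fun=> c) x.
Proof. by split; exact: cvg_cst. Qed.

Lemma continuousC_conj (f : T -> C) x :
  continuousC_at f x -> continuousC_at (fun z => conjc (f z)) x.
Proof.
have ReJ (a : C) : complex.Re (conjc a) = complex.Re a by case: a.
have ImJ (a : C) : complex.Im (conjc a) = - complex.Im a by case: a.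
move=> [cr ci]; split; first by under eq_fun do rewrite ReJ.
by under eq_fun do rewrite ImJ; exact: cvgN.
Qed.

Lemma continuousCM (f h : T -> C) x : continuousC_at f x -> continuousC_at h x ->
  continuousC_at (fun z => f z * h z) x.
Proof.
have ReM (a b : C) : complex.Re (a * b) =
    complex.Re a * complex.Re b - complex.Im a * complex.Im b by case: a b => ? ? [].
have ImM (a b : C) : complex.Im (a * b) =
    complex.Re a * complex.Im b + complex.Im a * complex.Re b by case: a b => ? ? [].
move=> [fr fi] [hr hi]; split.
  by under eq_fun do rewrite ReM; apply: cvgB; exact: continuousM.
by under eq_fun do rewrite ImM; apply: cvgD; exact: continuousM.
Qed.

Lemma continuousC_sum (I : Type) (r : seq I) (Q : pred I) (F : I -> T -> C) x :
  (forall i, continuousC_at (F i) x) ->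
  continuousC_at (fun z => \sum_(i <- r | Q i) F i z) x.
Proof.
have ReD (a b : C) : complex.Re (a + b) = complex.Re a + complex.Re b.
  by case: a b => ? ? [].
have ImD (a b : C) : complex.Im (a + b) = complex.Im a + complex.Im b.
  by case: a b => ? ? [].
move=> cF; elim: r => [|i r [IHr IHi]].
  by under eq_fun do rewrite big_nil; exact: continuousC_cst.
under eq_fun do rewrite big_cons; case: (Q i) => //; have [cr ci] := cF i; split.
  by under eq_fun do rewrite ReD; exact: cvgD.
by under eq_fun do rewrite ImD; exact: cvgD.
Qed.

Lemma continuousC_prod (I : Type) (r : seq I) (Q : pred I) (F : I -> T -> C) x :
  (forall i, continuousC_at (F i) x) ->
  continuousC_at (fun z => \prod_(i <- r | Q i) F i z) x.
Proof.
move=> cF; elim: r => [|i r IH].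
  by under eq_fun do rewrite big_nil; exact: continuousC_cst.
by under eq_fun do rewrite big_cons; case: (Q i) => //; exact: continuousCM.
Qed.

End Continuity.

(** * Symmetry and definiteness of the L2 product *)

Section L2.
Context {R : realType} {X : topologicalType} {M : manifold4 R X}.
Hypothesis X_compact : compact [set: X].
Context {J : almost_complex M} (g : hermitian_metric J) (rho : partition_of_unity M).
Local Notation C := R[i].

Lemma cintegral4_conj (D : set 'rV[R]_4) (f : 'rV[R]_4 -> C) :
  cintegral4 D (fun y => conjc (f y)) = conjc (cintegral4 D f).
Proof.
rewrite /cintegral4 /= -integral4N; congr (_ +i* _); apply: eq_integral4 => y _;
  by case: (f y).
Qed.

Lemma eq_cintegral4 (D : set 'rV[R]_4) (f h : 'rV[R]_4 -> C) :
  (forall y, D y -> f y = h y) -> cintegral4 D f = cintegral4 D h.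
Proof.
by move=> fh; congr (_ +i* _); apply: eq_integral4 => y /fh ->.
Qed.

Lemma cintegral4N (D : set 'rV[R]_4) (f : 'rV[R]_4 -> C) :
  cintegral4 D (fun y => - f y) = - cintegral4 D f.
Proof.
apply/eqP; rewrite eq_complex /= -!integral4N.
by apply/andP; split; apply/eqP; apply: eq_integral4 => y _; case: (f y).
Qed.

Lemma L2_conj k (alpha beta : cform M k) :
  L2 g rho alpha beta = conjc (L2 g rho beta alpha).
Proof.
rewrite /L2 rmorph_sum; apply: eq_bigr => l _; rewrite -[RHS]cintegral4_conj.
apply: eq_cintegral4 => y iy.
have conjM (a : R) (b : C) : conjc (a%:C * b) = a%:C * conjc b.
  by rewrite rmorphM; congr (_ * _); exact: conjc_real.
by rewrite conjM -pairing_conj.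
Qed.

Lemma L2N k (alpha beta : cform M k) :
  L2 g rho alpha (fun i y I => - beta i y I) = - L2 g rho alpha beta.
Proof.
rewrite /L2 -sumrN; apply: eq_bigr => l _; rewrite -cintegral4N.
apply: eq_cintegral4 => y iy; rewrite -mulrN; congr (_ * _).
rewrite /pairing -mulrN; congr (_ * _); rewrite -sumrN; apply: eq_bigr => I _.
by rewrite -sumrN; apply: eq_bigr => K _; rewrite rmorphN mulrN.
Qed.

Lemma L2_bidegree_part k p (alpha beta : cform M k) :
  L2 g rho (bidegree_part (J := J) p alpha) beta =
  L2 g rho alpha (bidegree_part (J := J) p beta).
Proof.
rewrite /L2; apply: eq_bigr => l _; apply: eq_cintegral4 => y iy.
by rewrite pairing_bidegree_part.
Qed.

Definition L2_density k (beta : cform M k) (l : 'I_(psize rho)) y : R :=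
  pfun l (param (pchart l) y) * Num.sqrt (\det (g (pchart l) y)) *
  complex.Re (pairing g beta beta (pchart l) y).

Lemma Re_L2 k (beta : cform M k) : complex.Re (L2 g rho beta beta) =
  \sum_l integral4 (img (pchart l)) (L2_density beta l).
Proof.
rewrite /L2; pose Re_sum := raddf_sum (@complex.Re R : {additive Rcomplex R -> R}).
rewrite (Re_sum _ _ _ _) /=; apply: eq_bigr => l _.
apply: eq_integral4 => y _; rewrite /L2_density.
by case: (pairing _ _ _ _ _) => a b /=; rewrite mul0r subr0.
Qed.

Lemma L2_density_ge0 k (beta : cform M k) l y :
  img (pchart l) y -> 0 <= L2_density beta l y.
Proof.
move=> iy; rewrite /L2_density !mulr_ge0 ?sqrtr_ge0 ?pfun_ge0 //.
by have := pairing_ge0 g beta iy; rewrite lecE => /andP[_].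
Qed.

Lemma Re_L2_ge0 k (beta : cform M k) : 0 <= complex.Re (L2 g rho beta beta).
Proof.
rewrite Re_L2; apply: sumr_ge0 => l _; apply: integral4_ge0 => y.
exact: L2_density_ge0.
Qed.

Lemma L2_density_continuous k (beta : cform M k) l y : smooth_form beta ->
  img (pchart l) y -> {for y, continuous (L2_density beta l)}.
Proof.
move=> [bs _ _ _] iy.
have cg a b : cont_at (fun z => g (pchart l) z a b) y.
  by have [cg _] := g_smooth g (pchart l) a b 0%N; exact: cg.
rewrite -/(cont_at _ _).
apply: continuousM; first apply: continuousM.
- apply: continuous_comp; first exact: param_continuous.
  exact: pfun_continuous.
- apply: continuous_comp; first exact: continuous_at_det.
  exact: sqrt_continuous.
suff [] : continuousC_at (pairing g beta beta (pchart l)) y by [].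
have cb I : continuousC_at (fun z => beta (pchart l) z I) y.
  have [cr ci] := bs (pchart l) I.
  by split; [have [c _] := cr 0%N | have [c _] := ci 0%N]; exact: c.
rewrite /pairing; apply: continuousCM; first exact: continuousC_cst.
apply: continuousC_sum => I; apply: continuousC_sum => K.
apply: continuousCM; last exact: continuousC_conj.
apply: continuousCM => //; apply: continuousC_prod => b; apply: continuousC_real.
by apply: continuous_at_invmx => //; exact: metric_unit.
Qed.

Lemma coord_param (i : chart M) y :
  img i y -> coord i (param i y) = y /\ dom i (param i y).
Proof. by move=> [x dx <-]; rewrite coordK. Qed.

(** The chart integrals are nonnegative with sum zero, so each vanishes, and by continuity so does
    each density. Every point has some nonzero partition function, so the form vanishes there in the
    corresponding chart, and the transition rule carries this to every other chart. *)
Lemma L2_definite k (beta : cform M k) : smooth_form beta ->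
  complex.Re (L2 g rho beta beta) = 0 -> forall i y I, beta i y I = 0.
Proof.
move=> sb; rewrite Re_L2 => L0.
have dens0 l y : img (pchart l) y -> L2_density beta l y = 0.
  have I0 : integral4 (img (pchart l)) (L2_density beta l) = 0.
    move: L0 => /eqP; rewrite psumr_eq0.
      by move=> /allP/(_ l (mem_index_enum _))/eqP.
    by move=> l' _; apply: integral4_ge0 => z; exact: L2_density_ge0.
  (* Compactness of the support of [pfun l] supplies the two bounds asked by [integral4_eq0]: the
     density is bounded, and it vanishes off the compact set [L]. *)
  pose K := closure [set x | pfun l x != 0].
  have Kdom : K `<=` dom (pchart l) by exact: pfun_supp.
  have cK : compact K.
    by apply: subclosed_compact X_compact _ => //; exact: closed_closure.
  pose L := coord (pchart l) @` K.
  have cL : compact L.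
    apply: continuous_compact => //; apply: continuous_in_subspaceT => x /set_mem Kx.
    exact: coord_continuous (Kdom _ Kx).
  have Limg : L `<=` img (pchart l) by apply: image_subset.
  have cdL : compact (L2_density beta l @` L).
    apply: continuous_compact => //; apply: continuous_in_subspaceT => z /set_mem Lz.
    exact: L2_density_continuous (Limg _ Lz).
  have supp z : img (pchart l) z -> L2_density beta l z != 0 -> L z.
    move=> iz; rewrite /L2_density !mulf_eq0 !negb_or => /andP[/andP[pz _] _].
    have [<- _] := coord_param iz.
    by exists (param (pchart l) z) => //; apply: subset_closure.
  have [N [_ LN]] := compact_bounded cL.
  have [B [_ dB]] := compact_bounded cdL.
  (* [compact_bounded] gives a bound for each number strictly above [B] or [N], whence the added 1;
     [|B|] keeps the first bound nonnegative off the support. *)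
  apply: (@integral4_eq0 _ _ _ (`|B| + 1) (N + 1)) => //.
  - exact: img_open.
  - exact: L2_density_ge0.
  - by move=> z iz; exact: L2_density_continuous.
  - move=> z iz; have [->|/(supp z iz) Lz] := eqVneq (L2_density beta l z) 0.
      by rewrite addr_ge0.
    apply: le_trans (ler_norm _) _; apply: dB; last by exists z.
    by rewrite (le_lt_trans (ler_norm B)) // ltrDl.
  - by move=> z iz dz; apply: LN; [rewrite ltrDl | exact: supp].
have beta_l (l : 'I_(psize rho)) x : dom (pchart l) x -> pfun l x != 0 ->
    beta (pchart l) (coord (pchart l) x) = fun=> 0.
  move=> dx px; have ix : img (pchart l) (coord (pchart l) x) by exists x.
  apply: (pairing_eq0 (g := g)) => //.
  have := dens0 l _ ix; rewrite /L2_density coordK // => /eqP.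
  rewrite !mulf_eq0 (negPf px) /= gt_eqF /=; last first.
    by rewrite sqrtr_gt0 (metric_det_gt0 g ix).
  (* The density controls only the real part; the imaginary part vanishes because the pairing is
     nonnegative. *)
  move=> /eqP Re0; apply/eqP; rewrite eq_complex Re0 eqxx /=.
  by rewrite (ger0_Im (pairing_ge0 g beta ix)).
move=> i y I; have [sc out _ tr] := sb.
have [iy|] := pselect (img i y); last exact: out.
have [yx dx] := coord_param iy.
have [l px] : exists l, pfun (p := rho) l (param i y) != 0.
  apply: contrapT => /forallNP p0; have := pfun_sum rho (param i y).
  rewrite big1; first by move/eqP; rewrite eq_sym oner_eq0.
  by move=> l _; apply/eqP; rewrite -[_ == _]negbK; apply/negP/p0.
have dlx : dom (pchart l) (param i y).
  by apply: (pfun_supp (l := l)); exact: subset_closure.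
rewrite (tr i (pchart l)) ?/transition ?beta_l ?pull0 //.
by exists (param i y).
Qed.

End L2.

(** * Harmonic forms *)

Section Harmonic.
Context {R : realType} {X : topologicalType} {M : manifold4 R X}.
Hypothesis X_compact : compact [set: X].
Context {J : almost_complex M} (g : hermitian_metric J) (rho : partition_of_unity M).
Local Notation C := R[i].
Local Notation toC := (real_complex R).

Lemma smooth_form0 k : smooth_form (M := M) (fun _ _ (_ : k.-tuple 'I_4) => 0).
Proof.
have s0 U : smooth U (fun _ : 'rV[R]_4 => 0 : R).
  have c0 y : {for y, continuous (fun _ : 'rV[R]_4 => 0 : R)} by apply: cst_continuous.
  elim=> [|m IH]; split=> // a; split.
    by move=> y _; exact: derivable_cst.
  rewrite (_ : partial a _ = fun=> 0) //.
  by apply/funext => y; exact: derive_cst.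
split=> //.
  by move=> *; rewrite mulr0.
by move=> i j y _; rewrite pull0.
Qed.

Lemma bidegree_part0 k p :
  bidegree_part (M := M) (J := J) p (fun _ _ (_ : k.-tuple 'I_4) => 0) =
  fun _ _ _ => 0.
Proof.
apply/funext => i; apply/funext => y; apply/funext => I.
by rewrite /bidegree_part big1 // => S _; rewrite pull0.
Qed.

Lemma Apq0 k p : Apq (M := M) (J := J) p (fun _ _ (_ : k.-tuple 'I_4) => 0).
Proof. by split; [exact: smooth_form0 | exact: bidegree_part0]. Qed.

Lemma L2r0 k (alpha : cform M k) : L2 g rho alpha (fun _ _ _ => 0) = 0.
Proof.
have := L2N g rho alpha (fun _ _ _ => 0).
under eq_fun do under eq_fun do under eq_fun do rewrite oppr0.
by move/eqP; rewrite eq_sym eqNr => /eqP.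
Qed.

(** With [beta] the adjoint image of [alpha] and [gamma] that of d alpha, the harmonic equation
    reads gamma = - d beta, and the two adjunctions give |d alpha|^2 = - |beta|^2. Co-closedness is
    phrased through pairings because adjoints are given by graphs. *)
Lemma d_harmonic_closed_coclosed k (alpha : cform M k.+1) :
  d_harmonic g rho alpha ->
  (forall i y I, ext_d alpha i y I = 0) /\
  (forall phi, smooth_form phi -> L2 g rho (ext_d phi) alpha = 0).
Proof.
move=> [sa [beta [gamma [[_ sb adj0] [sda sg adj1] lap]]]].
have gE : gamma = fun i y I => - ext_d beta i y I.
  apply/funext => i; apply/funext => y; apply/funext => I.
  by apply/eqP; rewrite -addr_eq0 addrC lap.
have Lda : L2 g rho (ext_d alpha) (ext_d alpha) = - conjc (L2 g rho beta beta).
  by rewrite adj1 // gE L2N L2_conj adj0.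
have ReN (a : C) : complex.Re (- conjc a) = - complex.Re a by case: a.
have ReL := congr1 (@complex.Re R) Lda; rewrite ReN in ReL.
have b0 := Re_L2_ge0 g rho beta; have a0 := Re_L2_ge0 g rho (ext_d alpha).
have Rb : complex.Re (L2 g rho beta beta) = 0.
  by apply/eqP; rewrite eq_le b0 andbT -oppr_ge0 -ReL.
split.
  by apply: (L2_definite (g := g) (rho := rho) X_compact sda); rewrite ReL Rb oppr0.
move=> phi sphi; rewrite adj0 //.
have -> : beta = fun _ _ _ => 0.
  by apply/funext => i; apply/funext => y; apply/funext => I;
    exact: (L2_definite X_compact sb Rb).
exact: L2r0.
Qed.

(* For a (1,1)-form the self-adjointness of the bidegree projection lets d be
   replaced by dbar in the co-closedness relation. *)
Lemma d_harmonic_dbar_harmonic k p (alpha : cform M k.+1) :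
  Apq (J := J) p alpha -> d_harmonic g rho alpha -> dbar_harmonic g rho p alpha.
Proof.
move=> Aa /d_harmonic_closed_coclosed[da0 dstar0]; split=> //.
have dbara0 : dbar (J := J) p alpha = fun _ _ _ => 0.
  rewrite /dbar (_ : ext_d alpha = fun _ _ _ => 0) ?bidegree_part0 //.
  by apply/funext => i; apply/funext => y; apply/funext => I.
(* Both adjoint images, of [alpha] and of its dbar, are zero. *)
exists (fun _ _ _ => 0), (fun _ _ _ => 0); split.
- split=> //; first exact: Apq0.
  move=> phi [sphi _]; rewrite /dbar L2_bidegree_part L2r0.
  by have [_ ->] := Aa; exact: dstar0.
- rewrite dbara0; split; try exact: Apq0.
  by move=> phi _; rewrite !L2r0.
- move=> i y I; rewrite addr0 /dbar.
  rewrite (_ : ext_d _ = fun _ _ _ => 0) ?bidegree_part0 //.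
  apply/funext => {}i; apply/funext => {}y; apply/funext => {}I.
  rewrite /ext_d; case: asboolP => // _; rewrite big1 // => a _.
  rewrite (_ : cpartial _ _ _ = 0) ?mulr0 //.
  by apply/eqP; rewrite eq_complex; apply/andP; split; apply/eqP; exact: derive_cst.
Qed.

Lemma Hminus_sub_H11 : Hminus g rho `<=` H11_dbar g rho.
Proof. by move=> alpha [Aa ha _]; exact: d_harmonic_dbar_harmonic. Qed.

Lemma anti_self_dual_Apq11 (gamma : cform M 2) :
  smooth_form gamma -> anti_self_dual g gamma -> Apq (k := 2) (J := J) 1 gamma.
Proof.
move=> sg asd; split=> //; have [_ out alt _] := sg.
apply/funext => i; apply/funext => y.
have [iy|niy] := pselect (img i y); last first.
  (* Off the chart image all components are 0 by convention. *)
  rewrite (_ : gamma i y = fun=> 0); last by apply/funext => I; exact: out.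
  apply/funext => I; rewrite /bidegree_part big1 // => S _.
  rewrite (_ : gamma i y = fun=> 0) ?pull0 //.
  by apply/funext => K; exact: out.
apply: bidegree_part11.
apply: (antiselfdual_type11 (J_square J iy) (g_sym g iy)
  (fun w => g_pos g iy (v := w)) (g_invariant g iy)).
  (* Antisymmetry is the alternation rule for the transposition of the two slots. *)
  apply/matrixP => a b; rewrite !mxE.
  have := alt i y (tperm ord0 ord_max) [tuple a; b].
  rewrite odd_tperm /= expr1 mulN1r => <-; congr (gamma i y _).
  rewrite [RHS]tuple2E !tnth_mktuple tpermL tpermR.
  by congr [tuple _; _].
move=> c e; rewrite mxE -(asd i y [tuple c; e]) /hodge_star.
congr (_ * _); apply: eq_bigr => a _; apply: eq_bigr => b _.
by apply: eq_bigr => a' _; apply: eq_bigr => b' _; rewrite mxE.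
Qed.

(** For real forms, the real and imaginary parts of a complex relation are two real relations. *)
Lemma lin_indep_complexify k n (e : 'I_n -> cform M k) :
  (forall a, real_form (e a)) -> lin_indep toC e -> lin_indep (@id C) e.
Proof.
move=> re ind c c0 a.
have Ree b i y I : e b i y I = toC (complex.Re (e b i y I)).
  by have := re b i y I; case: (e b i y I) => ? ? /= ->.
have split_sum i y I : \sum_b c b * e b i y I =
    (\sum_b complex.Re (c b) * complex.Re (e b i y I)) +i*
    (\sum_b complex.Im (c b) * complex.Re (e b i y I)).
  elim/big_rec3: _ => // b z t s _ ->; rewrite Ree; case: (c b) => u w.
  by apply/eqP; rewrite eq_complex /= !mulr0 subr0 add0r !eqxx.
have [Re0 Im0] : complex.Re (c a) = 0 /\ complex.Im (c a) = 0.
  split; [apply: (ind (fun b => complex.Re (c b)))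
         |apply: (ind (fun b => complex.Im (c b)))] => i y I;
    have := c0 i y I; rewrite split_sum => /eqP; rewrite eq_complex /=;
    move=> /andP[/eqP Re0 /eqP Im0];
    [have := congr1 toC Re0 | have := congr1 toC Im0];
    rewrite rmorph_sum rmorph0; apply: etrans;
    by apply: eq_bigr => b _; rewrite Ree -rmorphM.
by apply/eqP; rewrite eq_complex Re0 Im0 !eqxx.
Qed.

(** A family counted by [bminus] is, unchanged, a complex-independent family in [H11_dbar], so the
    suprema compare without any finiteness. *)
Lemma bminus_le_h11 : (bminus g rho <= h11_dbar g rho)%E.
Proof.
apply: le_ereal_sup => _ [n [e [eV ind]] <-]; exists n => //; exists e.
split; last by apply: lin_indep_complexify => // a; have [] := eV a.
move=> a; have [_ ha asd] := eV a; apply: Hminus_sub_H11; split=> //.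
by apply: anti_self_dual_Apq11 => //; case: ha.
Qed.

End Harmonic.

Theorem proposition3p8 (R : realType) (X : topologicalType)
    (M : manifold4 R X) (X_compact : compact [set: X])
    (J : almost_complex M) (g : hermitian_metric J) (rho : partition_of_unity M) :
  Hminus g rho `<=` H11_dbar g rho /\
  (bminus g rho <= h11_dbar g rho)%E.
Proof. by split; [exact: Hminus_sub_H11 | exact: bminus_le_h11]. Qed.
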